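(* Fix a deformation $\boldsymbol{\chi}_h$, a first Piola–Kirchhoff stress field $\mathbb{P}^{\mathrm e}$, an Eulerian grid velocity $\boldsymbol{u}$, a regularized delta function $\delta_h$, and a quadrature rule $\mathbb{H}$ used for the load vector. Suppose that the force projection, the force spreading, and the velocity projection operators of the immersed finite element-finite difference (IFED) method are all discretized with the same nodal quadrature rule $\mathbb{N}=\{(\boldsymbol{X}_q,w_q)\}_{q=1}^m$ whose points are the mesh nodes, as described in the context. Then the weights $w_q$ (equivalently, the diagonal entries of the diagonal mass matrix $\mathbb{D}$) can be chosen as arbitrary nonzero values: the spread Eulerian force $(f^1,f^2,f^3)$ on the Cartesian grid and the vector $\vec{\boldsymbol{U}}$ of finite element coefficients of the projected structural velocity are the same for every choice of nonzero real weights $w_1,\dots,w_m$.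
   Context: Structure and finite element space. The reference configuration $\Omega_0^{\mathrm s}\subset\mathbb{R}^3$ of a structure is triangulated by a mesh $\mathcal{T}^h$ with nodes $\boldsymbol{X}_1,\dots,\boldsymbol{X}_m$. $V^h\subset H^1(\mathcal{T}^h)^3$ is a $3m$-dimensional vector-valued nodal finite element space with basis $\{\boldsymbol{\phi}_\ell\}_{\ell=1}^{3m}$; each $\boldsymbol{\phi}_\ell$ is nonzero in only one component, and for each node $\boldsymbol{X}_k$, $\boldsymbol{\phi}_k(\boldsymbol{X}_k)=(1,0,0)$, $\boldsymbol{\phi}_{m+k}(\boldsymbol{X}_k)=(0,1,0)$, $\boldsymbol{\phi}_{2m+k}(\boldsymbol{X}_k)=(0,0,1)$, and all other basis functions vanish at $\boldsymbol{X}_k$. No positivity of the basis functions or their integrals is assumed. The deformation is $\boldsymbol{\chi}_h:\Omega_0^{\mathrm s}\to\mathbb{R}^3$, $\boldsymbol{\chi}_h\in V^h$ (time is fixed and suppressed). For a coefficient vector $\vec{\boldsymbol F}=(F_\ell)_{\ell=1}^{3m}$, write $F^d_k=F_{(d-1)m+k}$ for $d=1,2,3$ (the $d$th component at node $\boldsymbol{X}_k$), and similarly for other coefficient vectors. Grid. The Eulerian variables live on a uniform staggered Cartesian grid of spacing $\Delta x$: the $d$th components of the force $f^d$ and velocity $u^d$ are stored at the centers of the cell faces perpendicular to the $d$th axis. Denote by $\mathcal{G}_d$ the finite set of these face centers. $\delta_h:\mathbb{R}^3\to\mathbb{R}$ is the regularized delta function. Nodal mass matrix. Given nonzero weights $w_1,\dots,w_m$,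 $\mathbb{D}_{i,j}=\sum_{q=1}^m \boldsymbol{\phi}_i(\boldsymbol{X}_q)\cdot\boldsymbol{\phi}_j(\boldsymbol{X}_q)\,w_q$, which is diagonal with $\mathbb{D}_{i,i}=w_k$ for $i\in\{k,m+k,2m+k\}$. Force projection. The coefficient vector $\vec{\boldsymbol F}$ solves $\mathbb{D}\vec{\boldsymbol F}=\vec{\boldsymbol L}$, where $L_i=-\sum_{(\boldsymbol{Y},v)\in\mathbb{H}}\mathbb{P}^{\mathrm e}(\boldsymbol{Y}):\nabla_{\boldsymbol{X}}\boldsymbol{\phi}_i(\boldsymbol{Y})\,v$, and $\mathbb{H}$ is a fixed quadrature rule (points $\boldsymbol{Y}$ and weights $v$) that does not depend on the $w_q$. Force spreading. For $d=1,2,3$ and each $\boldsymbol{x}\in\mathcal{G}_d$, $f^d(\boldsymbol{x})=\sum_{q=1}^m F^d_q\,\delta_h(\boldsymbol{x}-\boldsymbol{\chi}_h(\boldsymbol{X}_q))\,w_q$. Velocity projection. For $d=1,2,3$ define $U^{\mathrm{IB},d}(\boldsymbol{X})=\sum_{\boldsymbol{x}\in\mathcal{G}_d}u^d(\boldsymbol{x})\,\delta_h(\boldsymbol{x}-\boldsymbol{\chi}_h(\boldsymbol{X}))\,\Delta x^3$ and $\boldsymbol{U}^{\mathrm{IB}}=(U^{\mathrm{IB},1},U^{\mathrm{IB},2},U^{\mathrm{IB},3})$. The coefficient vector $\vec{\boldsymbol U}$ of $\boldsymbol{U}_h=\sum_\ell U_\ell\boldsymbol{\phi}_\ell$ solves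 the nodally integrated projection equation $\mathbb{D}\vec{\boldsymbol U}=\vec{\boldsymbol b}$ with $b_i=\sum_{q=1}^m\boldsymbol{U}^{\mathrm{IB}}(\boldsymbol{X}_q)\cdot\boldsymbol{\phi}_i(\boldsymbol{X}_q)\,w_q$. *)

(* Defs.v *)
From HB Require Import structures.
From mathcomp Require Import all_boot all_order all_algebra finmap.
From mathcomp Require Import all_classical all_reals all_analysis.
Set Implicit Arguments.
Unset Strict Implicit.
Unset Printing Implicit Defensive.
Import Order.TTheory GRing.Theory Num.Theory.
Import numFieldNormedType.Exports.
Local Open Scope classical_set_scope.
Local Open Scope ring_scope.

Notation E3 R := 'rV[R]_3.

Section Euclidean.
Context {R : realType}.

Definition dot (u v : E3 R) : R := \sum_(d < 3) u 0 d * v 0 d.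

Definition frobenius (A B : 'M[R]_3) : R := \sum_(i < 3) \sum_(j < 3) A i j * B i j.

(* [jacobian] acts on row vectors, so its (j, i) entry is the derivative of the
   i-th component in the j-th direction; the transpose restores the usual
   layout (grad f) i j = d f_i / d X_j. *)
Definition grad (f : E3 R -> E3 R) (Y : E3 R) : 'M[R]_3 :=
  (jacobian f Y)^T.

End Euclidean.

(* The Sobolev space H^1 of an open set U of R^3.  Lebesgue measure on R^3 is
   the product measure on R * R * R, transported along [vec3]. *)
Section Sobolev.
Context {R : realType}.

Definition vec3 (p : R * R * R) : E3 R :=
  \row_(j < 3) [:: p.1.1; p.1.2; p.2]`_j.

Definition leb3 : set (R * R * R) -> \bar R :=
  ((@lebesgue_measure R \x @lebesgue_measure R) \x @lebesgue_measure R)%E.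

Definition integral3 (U : set (E3 R)) (f : E3 R -> R) : R :=
  (\int[leb3]_(p in vec3 @^-1` U) f (vec3 p))%R.

Definition partial (j : 'I_3) (f : E3 R -> R) : E3 R -> R :=
  fun x => 'D_(delta_mx 0 j) f x.

Definition smooth (f : E3 R -> R) : Prop :=
  forall s : seq 'I_3,
    continuous (foldr partial f s) /\
    forall j x, derivable (foldr partial f s) x (delta_mx 0 j).

Definition test_function (U : set (E3 R)) (f : E3 R -> R) : Prop :=
  smooth f /\
  exists K, [/\ compact K, K `<=` U & forall x, ~ K x -> f x = 0].

Definition square_integrable (U : set (E3 R)) (f : E3 R -> R) : Prop :=
  measurable_fun (vec3 @^-1` U) (f \o vec3) /\
  leb3.-integrable (vec3 @^-1` U) (fun p => ((f (vec3 p)) ^+ 2)%:E).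

Definition weak_partial (U : set (E3 R)) (j : 'I_3)
    (f g : E3 R -> R) : Prop :=
  forall t, test_function U t ->
    integral3 U (fun x => f x * partial j t x) =
    - integral3 U (fun x => g x * t x).

Definition H1 (U : set (E3 R)) (f : E3 R -> R) : Prop :=
  square_integrable U f /\
  forall j, exists2 g, square_integrable U g & weak_partial U j f g.

End Sobolev.

Section FiniteElements.
Context {R : realType}.

Record is_mesh (Omega : set (E3 R)) (T : seq (set (E3 R))) : Prop := {
  mesh_compact : forall K, K \in T -> compact K;
  mesh_regular : forall K, K \in T -> K !=set0 /\ closure K° = K;
  mesh_disjoint : forall i j, (i < j < size T)%N ->
    (nth set0 T i)° `&` (nth set0 T j)° = set0;
  mesh_cover : \bigcup_(K in [set` T]) K = closure Omega }.

(* The broken space H^1(T)^3.  It contains the conforming one, so requiring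
   V^h to be a subset of it covers both readings. *)
Definition H1_mesh (T : seq (set (E3 R))) : set (E3 R -> E3 R) :=
  [set v | forall K, K \in T -> forall d : 'I_3, H1 K° (fun x => v x 0 d)].

Fact dof_subproof m (d : 'I_3) (k : 'I_m) : (d * m + k < 3 * m)%N.
Proof.
apply: (@leq_trans (d.+1 * m)); first by rewrite mulSn addnC ltn_add2r.
by rewrite leq_mul2r ltn_ord orbT.
Qed.

(* Component d (counted from 0) at node k. *)
Definition dof m (d : 'I_3) (k : 'I_m) : 'I_(3 * m) := Ordinal (dof_subproof d k).

Definition fe_fun m (phi : 'I_(3 * m) -> E3 R -> E3 R)
    (c : 'cV[R]_(3 * m)) (x : E3 R) : E3 R :=
  \sum_l c l 0 *: phi l x.

(* Functions are total; as elements of V^h only their values on the closed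
   meshed region count. *)
Definition fe_space m (Omega : set (E3 R))
    (phi : 'I_(3 * m) -> E3 R -> E3 R) : set (E3 R -> E3 R) :=
  [set v | exists c, forall x, closure Omega x -> v x = fe_fun phi c x].

Record nodal_basis m (Omega : set (E3 R)) (X : 'I_m -> E3 R)
    (Vh : set (E3 R -> E3 R))
    (phi : 'I_(3 * m) -> E3 R -> E3 R) : Prop := {
  nodal_span : Vh = fe_space Omega phi;
  nodal_free : forall c : 'cV[R]_(3 * m),
    (forall x, closure Omega x -> fe_fun phi c x = 0) -> c = 0;
  nodal_component : forall l, exists d : 'I_3,
    forall x, closure Omega x -> forall e, e != d -> phi l x 0 e = 0;
  nodal_value : forall k d, phi (dof d k) (X k) = delta_mx 0 d;
  nodal_vanish : forall k l, (forall d, l != dof d k) -> phi l (X k) = 0 }.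

End FiniteElements.

Section Grid.
Context {R : realType}.

(* Center of the face perpendicular to axis d with integer index i, on the
   staggered grid with origin x0: integer offset along d, half-integer offset
   along the two other axes. *)
Definition face_center (x0 : E3 R) (dx : R) (d : 'I_3) (i : 'I_3 -> int) :
    E3 R :=
  \row_(j < 3) (x0 0 j + dx * ((i j)%:~R + (if j == d then 0 else 2^-1))).

(* Any finite set of faces of the staggered lattice is allowed, so that boxes
   with physical or with periodic boundaries are both covered. *)
Definition staggered_grid (x0 : E3 R) (dx : R)
    (G : 'I_3 -> {fset E3 R}) : Prop :=
  forall d x, x \in G d -> exists i, x = face_center x0 dx d i.

End Grid.

Section IFED.
Context {R : realType}.
Variable m : nat.
Variables (X : 'I_m -> E3 R) (phi : 'I_(3 * m) -> E3 R -> E3 R).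

Definition mass_mx (w : 'I_m -> R) : 'M[R]_(3 * m) :=
  \matrix_(i, j) \sum_q dot (phi i (X q)) (phi j (X q)) * w q.

Definition load (H : seq (E3 R * R)) (P : E3 R -> 'M[R]_3) :
    'cV[R]_(3 * m) :=
  \col_i - \sum_(Yv <- H) frobenius (P Yv.1) (grad (phi i) Yv.1) * Yv.2.

Definition force_projection w H P (F : 'cV[R]_(3 * m)) : Prop :=
  mass_mx w *m F = load H P.

Definition spread_force (delta : E3 R -> R) (chi : E3 R -> E3 R)
    (w : 'I_m -> R) (F : 'cV[R]_(3 * m)) (d : 'I_3) (x : E3 R) : R :=
  \sum_q F (dof d q) 0 * delta (x - chi (X q)) * w q.

Definition U_IB (G : 'I_3 -> {fset E3 R}) (dx : R) (delta : E3 R -> R)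
    (chi : E3 R -> E3 R) (u : 'I_3 -> E3 R -> R) (Z : E3 R) :
    E3 R :=
  \row_(d < 3) \sum_(x <- G d) u d x * delta (x - chi Z) * dx ^+ 3.

Definition velocity_rhs (V : E3 R -> E3 R) (w : 'I_m -> R) :
    'cV[R]_(3 * m) :=
  \col_i \sum_q dot (V (X q)) (phi i (X q)) * w q.

Definition velocity_projection G dx delta chi u w (U : 'cV[R]_(3 * m)) : Prop :=
  mass_mx w *m U = velocity_rhs (U_IB G dx delta chi u) w.

End IFED.

(* Main.v *)
(** At the nodes the basis is Kronecker, so row [dof d k] of the mass system reads
    [w k * F d k = L d k].  The spread force only involves the products
    [F d k * w k = L d k], in which the weight has disappeared, and in the velocity
    projection both sides carry the same factor [w k]. *)

Require Import Defs.
From HB Require Import structures.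
From mathcomp Require Import all_boot all_order all_algebra finmap.
From mathcomp Require Import all_classical all_reals all_analysis.
Import Order.TTheory GRing.Theory Num.Theory.
Import numFieldNormedType.Exports.
Local Open Scope classical_set_scope.
Local Open Scope ring_scope.

Set Implicit Arguments.
Unset Strict Implicit.
Unset Printing Implicit Defensive.

Section Dof.
Context (m : nat).

(** Uniqueness of Euclidean division by [m]: the node is the remainder of the index and the
    component its quotient. *)
Lemma dof_inj (d e : 'I_3) (k l : 'I_m) : dof d k = dof e l -> d = e /\ k = l.
Proof.
move=> /(congr1 val)/= E; have m_gt0 : (0 < m)%N by case: k {E} => [[]]; case: m.
have Ekl : k = l.
  apply: val_inj; move: (congr1 (modn^~ m) E).
  by rewrite !modnMDl !modn_small.
split=> //; apply: val_inj; move: (congr1 (divn^~ m) E).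
by rewrite !divnMDl // !divn_small // !addn0.
Qed.

Lemma dof_onto (l : 'I_(3 * m)) : exists (d : 'I_3) (k : 'I_m), l = dof d k.
Proof.
have m_gt0 : (0 < m)%N by case: m l => // -[]; rewrite muln0.
have ltd : (l %/ m < 3)%N by rewrite ltn_divLR.
have ltk : (l %% m < m)%N by rewrite ltn_mod.
exists (Ordinal ltd), (Ordinal ltk); apply: val_inj => /=.
exact: divn_eq.
Qed.

Lemma col_dofP (R : Type) (b c : 'cV[R]_(3 * m)) :
  (forall d k, b (dof d k) 0 = c (dof d k) 0) -> b = c.
Proof.
move=> bc; apply/colP => l; have [d [k ->]] := dof_onto l; exact: bc.
Qed.

End Dof.

Lemma dot_delta (R : realType) (v : E3 R) (d : 'I_3) :
  dot v (delta_mx 0 d) = v 0 d.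
Proof.
rewrite /dot (bigD1 d) //= mxE !eqxx mulr1 big1 ?addr0 // => e ne.
by rewrite mxE (negPf ne) andbF mulr0.
Qed.

Section NodalQuadrature.
Context (R : realType) (m : nat) (Omega : set (E3 R)) (X : 'I_m -> E3 R).
Context (Vh : set (E3 R -> E3 R)) (phi : 'I_(3 * m) -> E3 R -> E3 R).
Context (hphi : nodal_basis Omega X Vh phi).

Lemma phi_other_node d k q : q != k -> phi (dof d k) (X q) = 0.
Proof.
move=> qk; apply: (nodal_vanish hphi) => e; apply: contra qk => /eqP.
by case/dof_inj => _ ->.
Qed.

(** The quadrature points are the interpolation nodes, so only [q = k] survives in the sum, and
    there the basis function is a unit vector. Since [V] is arbitrary, this covers both the mass
    matrix ([V] a basis function) and the right-hand side of the velocity projection. *)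
Lemma nodal_quadrature_dot (V : E3 R -> E3 R) (w : 'I_m -> R) d k :
  \sum_q dot (V (X q)) (phi (dof d k) (X q)) * w q = V (X k) 0 d * w k.
Proof.
rewrite (bigD1 k) //= (nodal_value hphi) dot_delta big1 ?addr0 // => q qk.
rewrite phi_other_node // /dot big1 ?mul0r // => e _.
by rewrite mxE mulr0.
Qed.

Lemma mass_mx_dof (w : 'I_m -> R) d k e l :
  mass_mx X phi w (dof d k) (dof e l) = w k *+ (dof d k == dof e l).
Proof.
rewrite mxE nodal_quadrature_dot.
have [/dof_inj[-> ->]|ne] := eqVneq (dof d k) (dof e l).
  by rewrite (nodal_value hphi) mxE !eqxx mul1r.
(* Distinct indices differ either in the node, where the basis function vanishes, or at a common
   node in the component, where the unit vectors are orthogonal. *)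
have [Elk|lk] := eqVneq l k; last by rewrite phi_other_node // mxE mul0r.
rewrite -Elk (nodal_value hphi) mxE /= (_ : (e == d) = false) ?mul0r //.
by apply: contraNF ne => /eqP ->; rewrite Elk.
Qed.

Lemma mass_mx_offdiag (w : 'I_m -> R) i j :
  i != j -> mass_mx X phi w i j = 0.
Proof.
have [d [k ->]] := dof_onto i; have [e [l ->]] := dof_onto j.
by rewrite mass_mx_dof => /negPf ->.
Qed.

Lemma mass_mx_diag (w : 'I_m -> R) d k :
  mass_mx X phi w (dof d k) (dof d k) = w k.
Proof. by rewrite mass_mx_dof eqxx. Qed.

Lemma mass_mx_mulE (w : 'I_m -> R) (c : 'cV[R]_(3 * m)) d k :
  (mass_mx X phi w *m c) (dof d k) 0 = w k * c (dof d k) 0.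
Proof.
rewrite mxE (bigD1 (dof d k)) //= mass_mx_diag big1 ?addr0 // => j ne.
by rewrite mass_mx_offdiag ?mul0r // eq_sym.
Qed.

(** A diagonal system with nonzero diagonal is solved by entrywise division. This makes both
    projections well posed. *)
Lemma mass_mx_solve (w : 'I_m -> R) (b : 'cV[R]_(3 * m)) :
  (forall q, w q != 0) -> exists! c, mass_mx X phi w *m c = b.
Proof.
move=> w_neq0; exists (\col_l (b l 0 / mass_mx X phi w l l)); split.
  apply: col_dofP => d k.
  by rewrite mass_mx_mulE mxE mass_mx_diag mulrC divfK.
move=> c <-; apply: col_dofP => d k.
by rewrite mxE mass_mx_mulE mass_mx_diag mulrAC divff ?mul1r.
Qed.

(** The quadrature weight of the spreading sum recombines with [F] into a row of the mass system,
    leaving only the load vector. *)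
Lemma spread_force_load (w : 'I_m -> R) H P (F : 'cV[R]_(3 * m)) delta chi d x :
  force_projection X phi w H P F ->
  spread_force X delta chi w F d x =
  \sum_q load phi H P (dof d q) 0 * delta (x - chi (X q)).
Proof.
move=> hF; apply: eq_bigr => q _.
by rewrite -hF mass_mx_mulE mulrC mulrA.
Qed.

(** After cancelling [w k], the projection is plain nodal interpolation of [U_IB]. *)
Lemma velocity_projection_nodal (w : 'I_m -> R) G dx delta chi u
    (U : 'cV[R]_(3 * m)) d k :
  w k != 0 -> velocity_projection X phi G dx delta chi u w U ->
  U (dof d k) 0 = U_IB G dx delta chi u (X k) 0 d.
Proof.
move=> wk_neq0 hU; apply: (mulfI wk_neq0).
by rewrite -mass_mx_mulE hU [LHS]mxE nodal_quadrature_dot mulrC.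
Qed.

End NodalQuadrature.

Unset Implicit Arguments.
Set Strict Implicit.
Set Printing Implicit Defensive.

Theorem theorem2 (R : realType)
  (Omega : set (E3 R)) (T : seq (set (E3 R))) (hT : is_mesh Omega T)
  (m : nat) (X : 'I_m -> E3 R) (hX : forall k, closure Omega (X k))
  (Vh : set (E3 R -> E3 R))
  (phi : 'I_(3 * m) -> E3 R -> E3 R)
  (hphi : nodal_basis Omega X Vh phi) (hVh : Vh `<=` H1_mesh T)
  (chi : E3 R -> E3 R) (hchi : Vh chi)
  (P : E3 R -> 'M[R]_3) (H : seq (E3 R * R))
  (x0 : E3 R) (dx : R) (hdx : 0 < dx)
  (G : 'I_3 -> {fset E3 R}) (hG : staggered_grid x0 dx G)
  (u : 'I_3 -> E3 R -> R) (delta : E3 R -> R) :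
  (forall w : 'I_m -> R, (forall q, w q != 0) ->
     [/\ (forall i j, i != j -> mass_mx X phi w i j = 0),
         (forall d k, mass_mx X phi w (dof d k) (dof d k) = w k),
         (exists! F, force_projection X phi w H P F) &
         (exists! U, velocity_projection X phi G dx delta chi u w U)]) /\
  (forall w w' : 'I_m -> R,
     (forall q, w q != 0) -> (forall q, w' q != 0) ->
     forall F F' U U' : 'cV[R]_(3 * m),
       force_projection X phi w H P F ->
       force_projection X phi w' H P F' ->
       velocity_projection X phi G dx delta chi u w U ->
       velocity_projection X phi G dx delta chi u w' U' ->
       (forall d x, x \in G d ->
          spread_force X delta chi w F d x = spread_force X delta chi w' F' d x)
       /\ U = U').
Proof.
split=> [w w_neq0|w w' w_neq0 w'_neq0 F F' U U' hF hF' hU hU'].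
  (* Existence of both solutions for every admissible [w] keeps the independence claim from being
     vacuous. *)
  split; first by move=> i j; apply: mass_mx_offdiag hphi _ _ _.
  - exact: mass_mx_diag hphi w.
  - exact: mass_mx_solve hphi _ _ w_neq0.
  - exact: mass_mx_solve hphi _ _ w_neq0.
(* In each case both sides are rewritten to one expression free of [w] and [w']. *)
split=> [d x _|].
  by rewrite (spread_force_load hphi _ _ _ _ hF) (spread_force_load hphi _ _ _ _ hF').
apply: col_dofP => d k.
by rewrite (velocity_projection_nodal hphi _ (w_neq0 k) hU)
           (velocity_projection_nodal hphi _ (w'_neq0 k) hU').
Qed.
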